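(* Let $m$ and $n$ be positive integers, and let $P_n^m$ be the $m$-th power of the path $P_n$ with $n$ edges. For all $k > \operatorname{diam}(P_n^m)$, $$rc_k(P_n^m)= \begin{cases} nk - \frac{n^2-m^2}{2m} &\text{ if } \lceil \frac{n}{m} \rceil \text{ is odd and } m\mid n,\\ nk - \frac{n^2-s^2}{2m} + 1 &\text{ if } \lceil \frac{n}{m} \rceil \text{ is odd and } m \nmid n,\\ nk - \frac{n^2}{2m} + 1 &\text{ if } \lceil \frac{n}{m}\rceil \text{ is even and } m\mid n,\\ nk - \frac{n^2-(m-s)^2}{2m} + 1 &\text{ if } \lceil \frac{n}{m} \rceil \text{ is even and } m \nmid n, \end{cases}$$ where $s \equiv n \pmod m$, with $0\le s<m$ ($s$ is used only in the cases $m\nmid n$).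
   Context: $P_n$ denotes the path with $n$ edges, hence $n+1$ vertices. $P_n^m$ is the graph on the same vertex set in which two distinct vertices are adjacent if and only if their distance in $P_n$ is at most $m$; equivalently, vertex set $\{0,1,\dots,n\}$ with distinct $i,j$ adjacent iff $|i-j|\le m$. $d(u,v)$ denotes graph distance and $\operatorname{diam}$ the diameter. For a positive integer $k$, a radio $k$-coloring of a graph $G$ is a function $\phi:V(G)\to\{0,1,\dots,\lambda\}$ (for some integer $\lambda\ge 0$) with $|\phi(u)-\phi(v)|\ge k+1-d(u,v)$ for all distinct $u,v\in V(G)$. Its span is the value of $\lambda$ when $\lambda$ is chosen to be attained as a color, i.e. its largest color. The radio $k$-chromatic number $rc_k(G)$ is the minimum span over all radio $k$-colorings of $G$.
   Formalization: The formal theorem adds the hypothesis m ≤ n; for n < m the graph is complete, so rc_k = nk, whereas the printed formula gives nk + 1 (e.g. n=1, m=2, k=2: actual value 2, formula 3), so the claim fails for every n < m. *)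

(* Defs.v *)
From mathcomp Require Import all_boot all_order all_algebra.

Set Implicit Arguments.
Unset Strict Implicit.
Unset Printing Implicit Defensive.

Import Order.TTheory GRing.Theory Num.Theory.

(* A finite simple graph is given by its adjacency relation on a finType. *)

Definition walk_of_length (T : finType) (e : rel T) (u v : T) (l : nat) : bool :=
  [exists p : l.-tuple T, path e u p && (last u p == v)].

(* Least length of a walk from u to v.  A shortest walk has fewer than #|T|
   edges, so the search range suffices; the value is #|T| when v is not
   reachable from u. *)
Definition gdist (T : finType) (e : rel T) (u v : T) : nat :=
  find (walk_of_length e u v) (iota 0 #|T|).

Definition diam (T : finType) (e : rel T) : nat :=
  \max_(u : T) \max_(v : T) gdist e u v.

Definition graph_power (T : finType) (e : rel T) (m : nat) : rel T :=
  fun u v => (u != v) && (gdist e u v <= m).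

(* n counts edges, so there are n.+1 vertices. *)
Definition path_graph (n : nat) : rel 'I_n.+1 :=
  fun i j => (i.+1 == j :> nat) || (j.+1 == i :> nat).
Arguments path_graph : clear implicits.

Definition path_power (n m : nat) : rel 'I_n.+1 :=
  graph_power (path_graph n) m.
Arguments path_power : clear implicits.

(* The inequality is taken in int, so the subtractions are not truncated. *)
Definition radio_coloring (T : finType) (e : rel T) (k : nat)
    (phi : T -> nat) : bool :=
  [forall u : T, forall v : T, (u != v) ==>
    ((k%:Z + 1 - (gdist e u v)%:Z)%R <= `|(phi u)%:Z - (phi v)%:Z|)%R].

Definition coloring_span (T : finType) (phi : T -> nat) : nat := \max_(v : T) phi v.

Definition radio_span (T : finType) (e : rel T) (k l : nat) : bool :=
  [exists phi : {ffun T -> 'I_l.+1},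
     radio_coloring e k (fun v => phi v) && (coloring_span (fun v => phi v) == l)].

Lemma radio_span_exists (T : finType) (e : rel T) (k : nat) :
  exists l, radio_span e k l.
Proof.
pose f (v : T) := (enum_rank v * k.+1)%N.
have fle v : f v < (coloring_span f).+1 by exact: (leq_bigmax (F := f)).
exists (coloring_span f); apply/existsP.
exists [ffun v => Ordinal (fle v)]; apply/andP; split; last first.
  by apply/eqP; apply: eq_bigr => v _; rewrite ffunE.
apply/forallP => u; apply/forallP => v; apply/implyP => neq_uv.
rewrite !ffunE /= /f.
apply: (@le_trans _ _ (k.+1%:Z)%R).
  by rewrite -addn1 PoszD lerBlDr lerDl.
rewrite !PoszM -mulrBl normrM; apply: ler_peMl => //.
have : ((enum_rank u : nat)%:Z != (enum_rank v : nat)%:Z)%R.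
  rewrite eqz_nat; apply: contra neq_uv => /eqP /val_inj /enum_rank_inj ->.
  exact: eqxx.
by rewrite -subr_eq0 -normr_gt0 -gtz0_ge1.
Qed.

(* The minimum is over the spans of all radio k-colorings, of which there is
   always at least one. *)
Definition radio_chromatic (T : finType) (e : rel T) (k : nat) : nat :=
  ex_minn (radio_span_exists e k).

(* Main.v *)
(* Distances in the m-th power of the path are ceil(|u - v| / m).  Fix a clique
   [c, c + m] of the graph and let L v be the distance from v to it; then
   d(u, v) <= L u + L v + 1.  Listing the vertices by increasing colour and
   summing the colour gaps k + 1 - d gives a span of at least n k - 2 sum L.
   If c > n - m - c, equality is impossible: an edge attaining it from a vertex
   of S = {v < c, v = c - 1 mod m} leads to N = {v >= c + m, v = c mod m}, the
   ends of the listing lie in the clique, and |N| <= |S|, whereas a path with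
   S in its interior and all neighbours of S in N needs |N| > |S|.

   Conversely, a listing whose edges all attain the bound (up to a total
   defect of one in the strict case) and in which any two consecutive distances
   sum to at most k + 2 yields a colouring of the optimal span.  Writing
   n = q m + s with s < m, such a listing runs for r = m - 1, ..., 0 through the
   zigzag between the residue class of r left of the clique and that of r + 1
   right of it, separating the zigzags by the vertices of the clique. *)
Require Import Defs.
From mathcomp Require Import all_boot all_order all_algebra zify ring.

Import Order.TTheory GRing.Theory Num.Theory.

(** * Ceiling division and distances in a power of a path *)

Definition cdiv (m x : nat) : nat := (x + m.-1) %/ m.

(** One of the two truncated differences vanishes, so their sum is [|u - v|]; colour differences are
    encoded the same way below. *)
Definition pdist (m u v : nat) : nat := cdiv m ((u - v) + (v - u)).

Lemma cdiv_leq (m x q : nat) : 0 < m -> (cdiv m x <= q) = (x <= q * m).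
Proof. by move=> m0; rewrite /cdiv -ltnS ltn_divLR // mulSn; lia. Qed.

Lemma cdiv_eq (m x q : nat) : 0 < m -> x <= q * m -> q * m < x + m -> cdiv m x = q.
Proof.
move=> m0 le_x lt_x; apply/eqP; rewrite eqn_leq cdiv_leq // le_x /=.
case: q lt_x {le_x} => // q lt_x.
by rewrite ltnNge cdiv_leq //; rewrite mulSn in lt_x; lia.
Qed.

Lemma cdivl (m x : nat) : 0 < m -> x <= cdiv m x * m.
Proof. by move=> m0; rewrite -cdiv_leq. Qed.

Lemma cdiv_le_self (m x : nat) : 0 < m -> cdiv m x <= x.
Proof. by move=> m0; rewrite cdiv_leq // leq_pmulr. Qed.

Lemma leq_cdiv (m x y : nat) : 0 < m -> x <= y -> cdiv m x <= cdiv m y.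
Proof. by move=> m0 le_xy; rewrite cdiv_leq // (leq_trans le_xy) ?cdivl. Qed.

Lemma pdistC (m u v : nat) : pdist m u v = pdist m v u.
Proof. by rewrite /pdist addnC. Qed.

Lemma pdist_gt0 (m u v : nat) : 0 < m -> u != v -> 0 < pdist m u v.
Proof. by move=> m0 neq; rewrite ltnNge cdiv_leq //; lia. Qed.

(** The bound [l < #|T|] keeps [l] in the range searched by [gdist], so [find] does not fall through
    to its default. *)
Lemma gdist_eq (T : finType) (e : rel T) (u v : T) (l : nat) :
  l < #|T| -> walk_of_length e u v l ->
  (forall l', walk_of_length e u v l' -> l <= l') -> gdist e u v = l.
Proof.
move=> lT wl minl; rewrite /gdist.
have szi : l < size (iota 0 #|T|) by rewrite size_iota.
have hs : has (walk_of_length e u v) (iota 0 #|T|).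
  by apply/hasP; exists l => //; rewrite mem_iota.
have := nth_find 0 hs; have := hs; rewrite has_find size_iota => lt_f.
rewrite nth_iota // => /minl le_l.
apply/eqP; rewrite eqn_leq le_l andbT leqNgt; apply/negP => lt.
by have := before_find 0 lt; rewrite nth_iota // wl.
Qed.

(** Adjacency is given pointwise so that the lemma serves twice: for the path itself, with [m = 1],
    and then for its power. *)
Lemma gdist_band (n m : nat) (e : rel 'I_n.+1) (u v : 'I_n.+1) : 0 < m ->
  (forall i j : 'I_n.+1, e i j = (i != j) && ((i - j) + (j - i) <= m)) ->
  gdist e u v = pdist m u v.
Proof.
move=> m0 eE; apply: gdist_eq.
- rewrite card_ord ltnS (leq_trans (cdiv_le_self _ _ m0)) //.
  by have := ltn_ord u; have := ltn_ord v; lia.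
(* The length is generalised to any [l] such that the gap lies between [l] and [l * m], a property
   that survives the induction. *)
- have [l lE] : exists l, l = pdist m u v by eexists.
  rewrite -lE; have := cdivl m ((u - v) + (v - u)) m0; rewrite -/(pdist m u v) -lE.
  have : l <= (u - v) + (v - u) by rewrite lE cdiv_le_self.
  elim: l u v {lE} => [|l IHl] u v.
    move=> _ h; apply/existsP; exists [tuple]; rewrite /=.
    by apply/eqP/val_inj => /=; lia.
  move=> le_l le_lm.
  (* keep the remaining gap at least l so that no step is idle *)
  have [x [x0 xm xl xlm]] : exists x, [/\ 0 < x, x <= m,
      x + l <= (u - v) + (v - u) & (u - v) + (v - u) <= x + l * m].
    exists (minn m ((u - v) + (v - u) - l)); rewrite mulSn in le_lm.
    by have := leq_pmulr l m0; rewrite /minn; case: ifP; split; lia.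
  have wb : (if u < v then u + x else u - x) < n.+1.
    by have := ltn_ord u; have := ltn_ord v; case: ifP; lia.
  pose w := Ordinal wb.
  have wE : (w : nat) = if u < v then u + x else u - x by [].
  have ew : e u w.
    rewrite eE; apply/andP; split; last by rewrite wE; case: ifP; lia.
    by apply/eqP => /(congr1 val) /=; case: ifP; lia.
  have [||p] := existsP (IHl w v _ _).
  + by rewrite wE; case: ifP; lia.
  + by rewrite wE; case: ifP; lia.
  move=> /andP[pp lp]; apply/existsP; exists [tuple of w :: p].
  by rewrite /= ew pp.
- move=> l /existsP[p /andP[pp /eqP lp]]; rewrite cdiv_leq //.
  have -> : l = size p by rewrite size_tuple.
  elim: (tval p) u pp lp => [|w q IHq] x /=; first by move=> _ ->; lia.
  move=> /andP[]; rewrite eE => /andP[_ le_xw] pq lq.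
  have triangle a b c A B : (a - b) + (b - a) <= A -> (b - c) + (c - b) <= B ->
    (a - c) + (c - a) <= A + B by lia.
  by rewrite mulSn; apply: triangle le_xw (IHq w pq lq).
Qed.

Lemma gdist_path_power (n m : nat) (u v : 'I_n.+1) : 0 < m ->
  gdist (path_power n m) u v = pdist m u v.
Proof.
move=> m0; apply: gdist_band => // i j; rewrite /path_power /graph_power.
congr (_ && _).
have -> : gdist (path_graph n) i j = pdist 1 i j.
  apply: gdist_band => // a b; rewrite /path_graph.
  have -> : (a != b) = (a != b :> nat) by [].
  by lia.
by rewrite /pdist /cdiv addn0 divn1.
Qed.

(** * Radio colourings as functions on natural numbers *)

Definition nat_radio (m n k : nat) (f : nat -> nat) : Prop :=
  forall u v, u <= n -> v <= n -> u != v ->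
    k.+1 <= pdist m u v + ((f u - f v) + (f v - f u)).

Lemma radio_coloringP (m n k : nat) (phi : 'I_n.+1 -> nat) : 0 < m ->
  radio_coloring (path_power n m) k phi <-> nat_radio m n k (fun i => phi (inord i)).
Proof.
move=> m0; split.
- move=> /forallP h u v le_u le_v neq.
  have /forallP/(_ (inord v))/implyP := h (inord u).
  rewrite gdist_path_power // !inordK //.
  have -> : inord u != inord v :> 'I_n.+1.
    by apply: contraNneq neq => /(congr1 val); rewrite /= !inordK // => ->.
  by move=> /(_ isT); lia.
- move=> h; apply/forallP => u; apply/forallP => v; apply/implyP => neq.
  have := h u v (leq_ord u) (leq_ord v) neq; rewrite !inord_val.
  by rewrite gdist_path_power //; lia.
Qed.

Lemma radio_chromatic_le (m n k b : nat) (f : nat -> nat) : 0 < m ->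
  nat_radio m n k f -> (forall v, v <= n -> f v <= b) ->
  radio_chromatic (path_power n m) k <= b.
Proof.
move=> m0 hf fb; pose phi (v : 'I_n.+1) := f v.
have rphi : radio_coloring (path_power n m) k phi.
  apply/(radio_coloringP _ _ _ _ m0) => u v le_u le_v neq.
  by rewrite /phi !inordK //; exact: hf.
rewrite /radio_chromatic; case: ex_minnP => l _ /(_ (coloring_span phi)) minl.
apply: (leq_trans (minl _)); last first.
  by apply/bigmax_leqP => v _; apply: fb; rewrite -ltnS.
(* [radio_span] asks for colours in an ordinal type whose top value is attained, so [phi] is retyped
   with its own span as bound. *)
have fle v : phi v < (coloring_span phi).+1 by exact: (leq_bigmax (F := phi)).
apply/existsP; exists [ffun v => Ordinal (fle v)].
have E : (fun v => [ffun v => Ordinal (fle v)] v : nat) =1 phi.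
  by move=> v; rewrite ffunE.
apply/andP; split; last by apply/eqP; apply: eq_bigr => v _; rewrite E.
apply/forallP => u; apply/forallP => v.
by rewrite !E; have /forallP/(_ u)/forallP/(_ v) := rphi.
Qed.

Lemma radio_chromatic_attained (m n k : nat) : 0 < m ->
  exists2 f, nat_radio m n k f
    & forall v, v <= n -> f v <= radio_chromatic (path_power n m) k.
Proof.
move=> m0; rewrite /radio_chromatic; case: ex_minnP => l /existsP[phi].
move=> /andP[/(radio_coloringP _ _ _ _ m0) h _] _.
exists (fun i => phi (inord i) : nat) => // v _.
by rewrite -ltnS.
Qed.

(** * Span bounds from listings of the vertices *)

Fixpoint route_length (m x : nat) (s : seq nat) : nat :=
  if s is y :: s' then pdist m x y + route_length m y s' else 0.

Lemma route_lengthE (m x : nat) (s : seq nat) :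
  route_length m x s =
  \sum_(j < size s) pdist m (nth 0 (x :: s) j) (nth 0 (x :: s) j.+1).
Proof.
elim: s x => [|y s IHs] x; first by rewrite big_ord0.
by rewrite big_ord_recl /= IHs.
Qed.

(** The colour gaps telescope, each being at least [k + 1] minus the distance. *)
Lemma nat_radio_route (m n k x : nat) (s : seq nat) (f : nat -> nat) :
  nat_radio m n k f -> all (fun v => v <= n) (x :: s) -> uniq (x :: s) ->
  path (fun u v => f u <= f v) x s ->
  f x + size s * k.+1 <= f (last x s) + route_length m x s.
Proof.
move=> hf; elim: s x => [|y s IHs] x /=; first by lia.
move=> /and3P[le_x le_y le_s] /and3P[xn yn us] /andP[le_xy ps].
have neq : x != y by move: xn; rewrite inE negb_or => /andP[].
have := hf x y le_x le_y neq.
have := IHs y _ _ ps; rewrite /= le_y le_s yn us => /(_ isT isT).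
by rewrite mulSn; lia.
Qed.

(** An optimal colouring yields a listing by sorting the vertices by colour; the last colour is at
    most the span. *)
Lemma radio_chromatic_lower (m n k b : nat) : 0 < m ->
  (forall (x : nat) (s : seq nat), perm_eq (x :: s) (iota 0 n.+1) ->
     route_length m x s <= b) ->
  n * k.+1 <= radio_chromatic (path_power n m) k + b.
Proof.
move=> m0 hb; have [f hf fle] := radio_chromatic_attained m n k m0.
pose w := sort (relpre f leq) (iota 0 n.+1).
have pw : perm_eq w (iota 0 n.+1) by rewrite perm_sort.
have sw : sorted (relpre f leq) w by apply: sort_sorted => a c; apply: leq_total.
move: pw sw; case: w => [|x s]; first by move/perm_size; rewrite size_iota.
move=> pw sw.
have mem_w v : v \in x :: s -> v <= n.
  by rewrite (perm_mem pw) mem_iota add0n ltnS.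
have aw : all (fun v => v <= n) (x :: s) by apply/allP.
have uw : uniq (x :: s) by rewrite (perm_uniq pw) iota_uniq.
have := nat_radio_route m n k x s f hf aw uw sw.
have -> : size s = n by have := perm_size pw; rewrite size_iota => -[].
have := fle _ (mem_w _ (mem_last x s)).
have := hb x s pw.
by move: (f _) (f _) (route_length m x s) (radio_chromatic _ _) => a c r t; lia.
Qed.

Definition color_at (m k : nat) (w : seq nat) (i : nat) : nat :=
  \sum_(j < i) (k.+1 - pdist m (nth 0 w j) (nth 0 w j.+1)).

(* If any two consecutive distances of the route sum to at most [k + 2], colours
   two steps apart differ by at least [k], so only consecutive vertices
   constrain the greedy colouring. *)
Lemma radio_chromatic_upper (m n k x : nat) (s : seq nat) : 0 < m ->
  perm_eq (x :: s) (iota 0 n.+1) ->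
  (forall u v, u <= n -> v <= n -> pdist m u v <= k) ->
  (forall i, i.+2 <= n -> pdist m (nth 0 (x :: s) i) (nth 0 (x :: s) i.+1) +
     pdist m (nth 0 (x :: s) i.+1) (nth 0 (x :: s) i.+2) <= k.+2) ->
  radio_chromatic (path_power n m) k + route_length m x s <= n * k.+1.
Proof.
move=> m0 pw dk d2.
have szs : size s = n by have := perm_size pw; rewrite size_iota => -[].
have mem_w v : (v \in x :: s) = (v <= n) by rewrite (perm_mem pw) mem_iota.
have uw : uniq (x :: s) by rewrite (perm_uniq pw) iota_uniq.
have nthn i : i <= n -> nth 0 (x :: s) i <= n.
  by move=> le_i; rewrite -mem_w mem_nth //= szs.
set w := x :: s in mem_w uw nthn d2 pw *.
pose c := color_at m k w.
(* By [dk] the truncated subtraction in [color_at] is exact. *)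
have cS i : i < n -> c i.+1 + pdist m (nth 0 w i) (nth 0 w i.+1) = c i + k.+1.
  move=> lt_i; rewrite /c /color_at big_ord_recr /= -addnA subnK //.
  exact: leqW (dk _ _ (nthn i (ltnW lt_i)) (nthn i.+1 lt_i)).
have cmono i j : i <= j -> c i <= c j.
  elim: j => [|j IHj]; first by rewrite leqn0 => /eqP ->.
  rewrite leq_eqVlt => /orP[/eqP -> //|/IHj le].
  by rewrite (leq_trans le) // /c /color_at big_ord_recr leq_addr.
have c2 i : i.+2 <= n -> c i + k <= c i.+2.
  move=> lt_i; have := d2 i lt_i.
  by have := cS i (ltnW lt_i); have := cS i.+1 lt_i; lia.
have cn : c n + route_length m x s = n * k.+1.
  rewrite route_lengthE szs -/w /c /color_at -big_split /=.
  rewrite -[n in n * _]card_ord -sum_nat_const; apply: eq_bigr => i _.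
  rewrite subnK //.
  exact: leqW (dk _ _ (nthn i (ltnW (ltn_ord i))) (nthn i.+1 (ltn_ord i))).
have wn v : v <= n -> index v w <= n by rewrite -mem_w -index_mem /= szs ltnS.
suff : radio_chromatic (path_power n m) k <= c n by lia.
apply: (@radio_chromatic_le _ _ _ _ (fun v => c (index v w))) => //; last first.
  by move=> v le_v; apply: cmono; apply: wn.
(* Neighbours in the listing satisfy the constraint with equality; at two steps or more, the colour
   gap [k] and a distance of at least one suffice. *)
have key i j : i < j -> j <= n ->
  k.+1 <= pdist m (nth 0 w i) (nth 0 w j) + (c j - c i).
  move=> lt_ij le_j; have : nth 0 w i != nth 0 w j.
    by rewrite nth_uniq //= ?szs; lia.
  move/(pdist_gt0 _ _ _ m0).
  have [->|] := eqVneq j i.+1; first by have := cS i; lia.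
  move=> nj; have lt2 : i.+2 <= j by lia.
  by have := cmono _ _ lt2; have := c2 i; lia.
move=> u v le_u le_v neq.
have iu := nth_index 0 (etrans (mem_w u) le_u).
have iv := nth_index 0 (etrans (mem_w v) le_v).
case: (ltngtP (index u w) (index v w)) => h.
- by have := key _ _ h (wn v le_v); rewrite iu iv; lia.
- by have := key _ _ h (wn u le_u); rewrite iu iv pdistC; lia.
- by move: neq; rewrite -iu h iv eqxx.
Qed.

(** * Levels with respect to a clique, and the length of a listing *)

(* The number of steps from [v] to the clique [[c, c + m]]. *)
Definition level (m c v : nat) : nat := cdiv m (c - v) + cdiv m (v - (c + m)).

Lemma cdiv0 (m : nat) : 0 < m -> cdiv m 0 = 0.
Proof. by move=> m0; apply: cdiv_eq. Qed.

Lemma cdivMD (m q x : nat) : 0 < m -> cdiv m (q * m + x) = q + cdiv m x.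
Proof. by move=> m0; rewrite /cdiv -addnA divnMDl. Qed.

(** Walk from [u] into the clique, cross it by at most one edge, and walk out to [v]. *)
Lemma pdist_le_level (m c u v : nat) : 0 < m ->
  pdist m u v <= (level m c u + level m c v).+1.
Proof.
move=> m0; rewrite /pdist /level cdiv_leq // mulSn !mulnDl.
have := cdivl m (c - u) m0; have := cdivl m (c - v) m0.
by have := cdivl m (u - (c + m)) m0; have := cdivl m (v - (c + m)) m0; lia.
Qed.

(** An inner vertex lends its level to two edges, an end to only one; this is why the end levels
    appear on the left. *)
Lemma route_length_le_level (m c x : nat) (s : seq nat) : 0 < m ->
  route_length m x s + level m c x + level m c (last x s)
    <= 2 * (\sum_(v <- x :: s) level m c v) + size s.
Proof.
move=> m0; elim: s x => [|y s IHs] x /=; first by rewrite big_seq1; lia.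
by rewrite big_cons; have := IHs y; have := pdist_le_level m c x y m0; lia.
Qed.

Lemma route_length_level_path (m c x : nat) (s : seq nat) :
  path (fun u v => level m c u + level m c v < pdist m u v) x s ->
  2 * (\sum_(v <- x :: s) level m c v) + size s
    <= route_length m x s + level m c x + level m c (last x s).
Proof.
elim: s x => [|y s IHs] x /=; first by rewrite big_seq1; lia.
by move=> /andP[xy ps]; rewrite big_cons; have := IHs y ps; lia.
Qed.

Lemma route_length_level_tight (m c x : nat) (s : seq nat) : 0 < m ->
  2 * (\sum_(v <- x :: s) level m c v) + size s <= route_length m x s ->
  [/\ path (fun u v => level m c u + level m c v < pdist m u v) x s,
      level m c x = 0 & level m c (last x s) = 0].
Proof.
move=> m0 h; have := route_length_le_level m c x s m0 => h'.
have [-> ->] : level m c x = 0 /\ level m c (last x s) = 0 by lia.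
split=> //.
(* The end terms are put back because the induction passes to tails that need not begin in the
   clique. *)
have {h h'} : 2 * (\sum_(v <- x :: s) level m c v) + size s
  <= route_length m x s + level m c x + level m c (last x s) by lia.
elim: s x => [|y s IHs] x //=.
rewrite big_cons => h.
have h1 := route_length_le_level m c y s m0; have h2 := pdist_le_level m c x y m0.
by apply/andP; split; [lia|apply: IHs; lia].
Qed.

(** * Strictness for a clique off centre *)

(* If the members of [S] are interior to the path and their neighbours lie in
   [N], then every member of [S] is followed by one of [N], and the first one
   is also preceded by one. *)
Lemma path_count_lt (T : eqType) (e : rel T) (S N : pred T) (x : T) (s : seq T) :
  (forall v, S v -> ~~ N v) -> (forall u v, e u v -> S u -> N v) ->
  (forall u v, e u v -> S v -> N u) ->
  path e x s -> ~~ S (last x s) -> ~~ S x -> has S s ->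
  count S (x :: s) < count N (x :: s).
Proof.
move=> SN eSN eNS ps Sl Sx hs.
(* The boolean records a member of [N] that is not the successor of a member of [S]: [x] itself, or
   the vertex just before the next entry into [S]. *)
suff : count S (x :: s) + (N x || ~~ S x && has S s) <= count N s + N x.
  by rewrite (negbTE Sx) hs orbT /= (negbTE Sx); lia.
elim: s x ps Sl {Sx hs} => [|y s IHs] x /=.
  by move=> _ /negbTE ->; rewrite andbF orbF; lia.
move=> /andP[exy ps] Sl; have := IHs y ps Sl => /=.
move: (SN x) (SN y) (eSN _ _ exy) (eNS _ _ exy).
by case: (S x) (N x) (S y) (N y) (has S s) => [] [] [] [] [] //= h1 h2 h3 h4;
  try lia; move: (h1 isT) (h2 isT) (h3 isT) (h4 isT).
Qed.

(** Such a [u] is the vertex of its level closest to the clique, which leaves no slack: [v] has to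
    be the farthest vertex of its own level on the right. *)
Lemma level_tight_left (m c u v : nat) : 0 < m -> u < c -> m %| c - u.+1 ->
  level m c u + level m c v < pdist m u v -> (c + m <= v) && (m %| v - c).
Proof.
move=> m0 lt_uc /dvdnP[j Ej].
have Lu : level m c u = j.+1.
  rewrite /level (_ : u - (c + m) = 0) ?cdiv0 // ?addn0; last by lia.
  by apply: cdiv_eq => //; rewrite ?mulSn; lia.
rewrite Lu; case: (leqP (c + m) v) => /= le_v; last first.
  have : pdist m u v <= maxn j.+1 (cdiv m (c - v)).
    rewrite /pdist cdiv_leq // maxnMl.
    have := cdivl m (c - v) m0; rewrite mulSn; lia.
  by rewrite /level; lia.
have -> : pdist m u v = j.+1 + cdiv m (v - (c + m)).+1.
  by rewrite -cdivMD // /pdist mulSn; congr cdiv; lia.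
have -> : level m c v = cdiv m (v - (c + m)).
  by rewrite /level (_ : c - v = 0) ?cdiv0 //; lia.
move=> h.
have -> : v - c = v - (c + m) + m by lia.
have : cdiv m (v - (c + m)) * m <= v - (c + m).
  by rewrite leqNgt; apply/negP; rewrite -cdiv_leq //; lia.
have := cdivl m (v - (c + m)) m0 => h1 h2.
by rewrite dvdn_addl //; apply/dvdnP; exists (cdiv m (v - (c + m))); lia.
Qed.

Lemma route_length_lt_level (m n c x : nat) (s : seq nat) :
  0 < m -> 0 < c -> c + m <= n -> n < c + c + m ->
  perm_eq (x :: s) (iota 0 n.+1) ->
  route_length m x s < 2 * (\sum_(v <- x :: s) level m c v) + n.
Proof.
move=> m0 c0 le_cm lt_n pw; rewrite ltnNge; apply/negP.
have -> : n = size s by have := perm_size pw; rewrite size_iota => -[].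
move=> /route_length_level_tight - /(_ m0)[ps Lx Ll].
pose S v := (v < c) && (m %| c - v.+1).
pose N v := (c + m <= v) && (m %| v - c).
have Slevel v : S v -> level m c v != 0.
  move=> /andP[lt_v _]; rewrite -lt0n /level addn_gt0.
  by rewrite (ltnNge 0) cdiv_leq // mul0n; lia.
have SN v : S v -> ~~ N v by move=> /andP[lt_v _]; rewrite /N negb_and; lia.
have eSN u v : level m c u + level m c v < pdist m u v -> S u -> N v.
  by move=> ed /andP[u1 u2]; apply: level_tight_left ed.
have eNS u v : level m c u + level m c v < pdist m u v -> S v -> N u.
  by rewrite addnC pdistC; apply: eSN.
have Sl : ~~ S (last x s) by apply/negP => /Slevel; rewrite Ll.
have Sx : ~~ S x by apply/negP => /Slevel; rewrite Lx.
have hs : has S s.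
  have : has S (x :: s).
    apply/hasP; exists c.-1; last by rewrite /S prednK // subnn dvdn0 andbT; lia.
    by rewrite (perm_mem pw) mem_iota; lia.
  by rewrite /= (negbTE Sx).
have := @path_count_lt nat _ S N x s SN eSN eNS ps Sl Sx hs.
rewrite ltnNge => /negP; apply.
have cnt P : count P (x :: s) = size (filter P (iota 0 n.+1)).
  by rewrite size_filter; apply/permP.
(* The reflection [v -> 2 c + m - 1 - v] sends [N] into [S]; since [n < c + c + m] it does not
   truncate on the listing and is injective there. *)
rewrite !cnt -(size_map (fun v => (c + c + m).-1 - v)); apply: uniq_leq_size.
  rewrite map_inj_in_uniq ?filter_uniq ?iota_uniq //.
  by move=> u v; rewrite !mem_filter !mem_iota; lia.
move=> w /mapP[v]; rewrite !mem_filter !mem_iota add0n => /andP[/andP[v1 v2] v3] ->.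
rewrite /S; have -> : c - ((c + c + m).-1 - v).+1 = v - c - m by lia.
by rewrite dvdn_subl //; lia.
Qed.

(** * The sum of the levels *)

Definition cdiv_sum (m q : nat) : nat := \sum_(a < q.+1) cdiv m a.

Lemma cdiv_sum0 (m : nat) : 0 < m -> cdiv_sum m 0 = 0.
Proof. by move=> m0; rewrite /cdiv_sum big_ord_recr big_ord0 /= cdiv0. Qed.

Lemma cdiv_sumS (m q : nat) : cdiv_sum m q.+1 = cdiv_sum m q + cdiv m q.+1.
Proof. by rewrite /cdiv_sum big_ord_recr. Qed.

(** The ceiling takes each of the values [1, ..., t] on [m] arguments, then [t + 1] on [a]
    arguments. Allowing [a = m] lets the induction pass from one block to the next. *)
Lemma cdiv_sumE (m t a : nat) : 0 < m -> a <= m ->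
  2 * cdiv_sum m (t * m + a) = m * t * t.+1 + 2 * a * t.+1.
Proof.
move=> m0; elim: t a => [|t IHt]; elim=> [|a IHa] le_a.
- by rewrite cdiv_sum0 //; ring.
- by rewrite addnS cdiv_sumS mulnDr IHa ?(ltnW le_a) // (_ : cdiv m _ = 1);
    [ring|apply: cdiv_eq => //; lia].
- by rewrite addn0 (mulSnr t) (IHt m (leqnn m)); ring.
- rewrite addnS cdiv_sumS mulnDr IHa ?(ltnW le_a) // (_ : cdiv m _ = t.+2).
    by ring.
  by apply: cdiv_eq => //; rewrite !mulSn; lia.
Qed.

Lemma sum_level (m n c : nat) : 0 < m -> c + m <= n ->
  \sum_(v <- iota 0 n.+1) level m c v = cdiv_sum m c + cdiv_sum m (n - (c + m)).
Proof.
move=> m0 le_n; rewrite -[iota 0 _]/(index_iota 0 n.+1) big_mkord big_split /=.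
congr (_ + _).
  have : c <= n by lia.
  elim: c n {le_n} => [|c IHc] n le_n.
    rewrite cdiv_sum0 // big1 // => i _.
    by rewrite sub0n cdiv0.
  case: n le_n => // n le_n; rewrite big_ord_recl cdiv_sumS addnC.
  by congr (_ + _); rewrite -(IHc n).
rewrite -[in LHS](subnKC le_n); elim: (n - (c + m)) => [|b IHb].
  rewrite addn0 big1 => [|i _]; first by rewrite cdiv_sum0.
  by rewrite (_ : i - (c + m) = 0) ?cdiv0 //; have := ltn_ord i; lia.
rewrite addnS big_ord_recr IHb cdiv_sumS /=; congr (_ + cdiv m _); lia.
Qed.

(** * Concatenated blocks and zigzags *)

Lemma last_mkseq (T : Type) (f : nat -> T) (N : nat) :
  last (f 0) (mkseq (f \o succn) N) = f N.
Proof. by case: N => // N; rewrite mkseqS last_rcons. Qed.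

Lemma path_mkseq (T : Type) (e : rel T) (f : nat -> T) (N : nat) :
  (forall i, i < N -> e (f i) (f i.+1)) -> path e (f 0) (mkseq (f \o succn) N).
Proof.
elim: N => // N IHN h.
by rewrite mkseqS rcons_path last_mkseq IHN ?h // => i /ltnW; apply: h.
Qed.

Section Descend.

Variables (T : eqType) (F : nat -> nat -> T) (N : nat -> nat).

(** Here [N r] is the last index of block [r], whose length is therefore [N r + 1]. The head is
    split off to fit the shape [x :: s] used by [path]. *)
Fixpoint descend (q : nat) : seq T :=
  if q is r.+1 then F r 0 :: mkseq (F r \o succn) (N r) ++ descend r else [::].

Lemma size_descend (q : nat) : size (descend q) = \sum_(r < q) (N r).+1.
Proof.
elim: q => [|q IHq]; first by rewrite big_ord0.
by rewrite /= size_cat size_mkseq IHq big_ord_recr /=; lia.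
Qed.

Lemma mem_descend (q r i : nat) : r < q -> i <= N r -> F r i \in descend q.
Proof.
move=> lt_r le_i; elim: q lt_r => // q IHq; rewrite ltnS leq_eqVlt.
case/orP => [/eqP <-{IHq}|/IHq h] /=; rewrite inE mem_cat; last by rewrite h !orbT.
case: i le_i => [|i] le_i; first by rewrite eqxx.
by rewrite (map_f (F r \o succn) (x := i)) ?orbT // mem_iota.
Qed.

Lemma descend_cons (q : nat) :
  0 < q -> descend q = F q.-1 0 :: behead (descend q).
Proof. by case: q. Qed.

Lemma path_descend (e : rel T) (q : nat) : 0 < q ->
  (forall r i, r < q -> i < N r -> e (F r i) (F r i.+1)) ->
  (forall r, r.+1 < q -> e (F r.+1 (N r.+1)) (F r 0)) ->
  path e (F q.-1 0) (behead (descend q)).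
Proof.
case: q => // q _; elim: q => [|q IHq] h1 h2 /=;
  rewrite cat_path path_mkseq ?last_mkseq //=; try by move=> i; apply: h1.
rewrite h2 //=; apply: IHq => [r i lt_r|r lt_r]; last by apply: h2; apply: ltnW.
by apply: h1; apply: ltnW.
Qed.

Lemma last_descend (x : T) (q : nat) : last x (descend q.+1) = F 0 (N 0).
Proof.
by elim: q x => [|q IHq] x; rewrite /= last_cat last_mkseq //; apply: IHq.
Qed.

End Descend.

Arguments descend {T}.

Lemma sum_step (q s K : nat) : \sum_(r < q) (K + (r < s)).+1 = q * K.+1 + minn q s.
Proof.
elim: q => [|q IHq]; first by rewrite big_ord0 min0n.
by rewrite big_ord_recr /= IHq; lia.
Qed.

(** The sequence [a, b, a + m, b + m, ...]. *)
Definition zig (m a b i : nat) : nat := (if odd i then b else a) + i./2 * m.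

Lemma zig_edge (e : rel nat) (m a b h : nat) :
  (forall j, j.*2 < h -> e (a + j * m) (b + j * m)) ->
  (forall j, j.*2.+1 < h -> e (b + j * m) (a + j.+1 * m)) ->
  forall i, i < h -> e (zig m a b i) (zig m a b i.+1).
Proof.
move=> h1 h2 i; rewrite /zig /= uphalf_half -{1}(odd_double_half i).
by case: (odd i) => /=; rewrite ?add0n ?add1n; [apply: h2 | apply: h1].
Qed.

Lemma zig_even (m a b j : nat) : zig m a b j.*2 = a + j * m.
Proof. by rewrite /zig odd_double doubleK. Qed.

Lemma zig_odd (m a b j : nat) : zig m a b j.*2.+1 = b + j * m.
Proof. by rewrite /zig /= odd_double uphalf_double. Qed.

(** * Edges that attain the level bound *)

Definition route_edge (m c b : nat) : rel nat := fun u v =>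
  (level m c u + level m c v < pdist m u v)
  && (pdist m u v <= b + (u < c <= v)).

Lemma pdist_eq (m u v q : nat) : 0 < m ->
  (u - v) + (v - u) <= q * m -> q * m < (u - v) + (v - u) + m -> pdist m u v = q.
Proof. exact: cdiv_eq. Qed.

(** For [e = 0] the left class has run on to the clique vertex [t m + r]. *)
Lemma level_left (m t j e r : nat) : r < m -> j + e = t ->
  level m (t * m) (r + j * m) = e.
Proof.
move=> lt_r <-; rewrite /level (_ : _ - (_ + m) = 0) ?cdiv0 ?addn0; try lia.
by apply: cdiv_eq; lia.
Qed.

Lemma level_right (m t j r : nat) : r < m ->
  level m (t * m) ((t.+1 * m + r).+1 + j * m) = j.+1.
Proof.
move=> lt_r; rewrite /level (_ : t * m - _ = 0) ?cdiv0 ?add0n; try lia.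
by apply: cdiv_eq; lia.
Qed.

Lemma level_center (m t y : nat) : 0 < m -> y <= m ->
  level m (t * m) (t * m + y) = 0.
Proof.
move=> m0 le_y; rewrite /level (_ : t * m - _ = 0) ?cdiv0 //; last by lia.
by rewrite (_ : _ - (t * m + m) = 0) ?cdiv0 //; lia.
Qed.

Lemma route_edgeI (m c b u v lu lv : nat) : 0 < m ->
  level m c u = lu -> level m c v = lv ->
  (u - v) + (v - u) <= (lu + lv).+1 * m ->
  (lu + lv) * m < (u - v) + (v - u) ->
  lu + lv < b + (u < c <= v) -> route_edge m c b u v.
Proof.
move=> m0 hu hv h1 h2 h3; rewrite /route_edge hu hv.
have -> : pdist m u v = (lu + lv).+1 by apply: pdist_eq; lia.
by rewrite leqnn h3.
Qed.

(** The classes differ by one modulo [m], so the gap exceeds [(e + j + 1) m] by just one and its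
    ceiling attains the bound. [0 < e] places the first vertex left of the clique, which grants the
    extra unit of length; the reverse direction has no such unit. *)
Lemma edge_left_right (m t b r i j e : nat) : 0 < m -> r < m ->
  i + e = t -> 0 < e -> e + j < b ->
  route_edge m (t * m) b (r + i * m) ((t.+1 * m + r).+1 + j * m).
Proof.
move=> m0 lt_r iet e0 ejb; apply: (@route_edgeI _ _ _ _ _ e j.+1) => //.
- exact: level_left.
- exact: level_right.
- by rewrite -iet; lia.
- by rewrite -iet; lia.
have -> : r + i * m < t * m <= (t.+1 * m + r).+1 + j * m; last by lia.
by rewrite -iet; nia.
Qed.

Lemma edge_right_left (m t b r i j e : nat) : 0 < m -> r < m ->
  i + e = t -> (e + j).+1 < b ->
  route_edge m (t * m) b ((t.+1 * m + r).+1 + j * m) (r + i * m).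
Proof.
move=> m0 lt_r iet ejb; apply: (@route_edgeI _ _ _ _ _ j.+1 e) => //.
- exact: level_right.
- exact: level_left.
- by rewrite -iet; lia.
- by rewrite -iet; lia.
- by lia.
Qed.

(** Whether a clique vertex [t m + y] fits is decided by its offset: [r < y] next to the left class,
    [y <= r] next to the right one. *)
Lemma edge_left_center (m t b r i e y : nat) : 0 < m -> r < m ->
  i + e = t -> y <= m -> r < y -> e < b ->
  route_edge m (t * m) b (r + i * m) (t * m + y).
Proof.
move=> m0 lt_r iet le_y lt_ry eb; apply: (@route_edgeI _ _ _ _ _ e 0) => //.
- exact: level_left.
- exact: level_center.
- by rewrite -iet; lia.
- by rewrite -iet; lia.
- by lia.
Qed.

Lemma edge_center_left (m t b r i e y : nat) : 0 < m -> r < m ->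
  i + e = t -> y <= m -> r < y -> e < b ->
  route_edge m (t * m) b (t * m + y) (r + i * m).
Proof.
move=> m0 lt_r iet le_y lt_ry eb; apply: (@route_edgeI _ _ _ _ _ 0 e) => //.
- exact: level_center.
- exact: level_left.
- by rewrite -iet; lia.
- by rewrite -iet; lia.
- by lia.
Qed.

Lemma edge_right_center (m t b r j y : nat) : 0 < m -> r < m ->
  y <= m -> y <= r -> j.+1 < b ->
  route_edge m (t * m) b ((t.+1 * m + r).+1 + j * m) (t * m + y).
Proof.
move=> m0 lt_r le_y le_yr jb; apply: (@route_edgeI _ _ _ _ _ j.+1 0) => //.
- exact: level_right.
- exact: level_center.
- by lia.
- by lia.
- by lia.
Qed.

Lemma edge_center_right (m t b r j y : nat) : 0 < m -> r < m ->
  y <= m -> y <= r -> j.+1 < b ->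
  route_edge m (t * m) b (t * m + y) ((t.+1 * m + r).+1 + j * m).
Proof.
move=> m0 lt_r le_y le_yr jb; apply: (@route_edgeI _ _ _ _ _ 0 j.+1) => //.
- exact: level_center.
- exact: level_right.
- by lia.
- by lia.
- by lia.
Qed.

(** * The listing for an even quotient *)

Section EvenRoute.

Variables (m t s : nat).
Hypotheses (m0 : 0 < m) (t0 : 0 < t) (lt_sm : s < m).

(* For [n = 2 t m + s] and the clique [[t m, t m + m]]: the [r]-th zigzag,
   followed by a clique vertex.  The listing starts with [t m + s], whose edge
   is the only one with a defect. *)
Definition even_route (r i : nat) : nat :=
  if (r < s) || (i < t.*2.-1) then zig m r (t.+1 * m + r).+1 i
  else t * m + r.+1.

(** The right class has a [t]-th vertex [2 t m + r + 1] exactly when [r < s]. The zigzag then runs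
    on to [t m + r]; otherwise it stops earlier and [t m + r + 1] is appended. The clique vertex
    left over is [t m + s]. *)
Definition even_size (r : nat) : nat := t.*2.-1 + (r < s).

Lemma even_zig (r i : nat) : r < m -> i < t.*2 ->
  route_edge m (t * m) t.+1
    (zig m r (t.+1 * m + r).+1 i) (zig m r (t.+1 * m + r).+1 i.+1).
Proof.
move=> lt_r; apply: zig_edge i => j lt_j.
  by apply: (@edge_left_right _ _ _ _ _ _ (t - j)) => //; lia.
by apply: (@edge_right_left _ _ _ _ _ _ (t - j.+1)) => //; lia.
Qed.

Lemma even_last (r : nat) :
  even_route r (even_size r) = t * m + (r + (s <= r)).
Proof.
rewrite /even_route /even_size; case: (ltnP r s) => h.
  by rewrite (_ : _ + true = t.*2) ?zig_even /=; lia.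
by rewrite addn0 ltnn /=; lia.
Qed.

Lemma even_first (r : nat) : even_route r 0 = r.
Proof.
rewrite /even_route (_ : 0 < _) ?orbT; last by lia.
by rewrite -[0]/(0.*2) zig_even addn0.
Qed.

Lemma even_route_step (r i : nat) : r < m -> i < even_size r ->
  route_edge m (t * m) t.+1 (even_route r i) (even_route r i.+1).
Proof.
move=> lt_r lt_i; have lt_i2 : i < t.*2 by move: lt_i; rewrite /even_size; lia.
have [lt_i1|le_i1] := boolP ((r < s) || (i.+1 < t.*2.-1)).
  have lt_i1' : (r < s) || (i < t.*2.-1) by lia.
  by rewrite /even_route lt_i1 lt_i1'; apply: even_zig.
have [ri si] : i = t.-1.*2 /\ r < s = false by move: lt_i; rewrite /even_size; lia.
rewrite /even_route (negbTE le_i1) (_ : _ || _); last by lia.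
rewrite ri zig_even; apply: (@edge_left_center _ _ _ _ _ 1) => //; lia.
Qed.

Lemma even_route_join (r : nat) : r.+1 < m ->
  route_edge m (t * m) t.+1
    (even_route r.+1 (even_size r.+1)) (even_route r 0).
Proof.
move=> lt_r; rewrite even_last even_first.
have := @edge_center_left m t t.+1 r 0 t (r.+1 + (s <= r.+1)).
by rewrite mul0n addn0; apply; lia.
Qed.

Definition even_tail : seq nat := descend even_route even_size m.

Lemma even_tail_cons : even_tail = m.-1 :: behead even_tail.
Proof. by rewrite /even_tail descend_cons // even_first. Qed.

Lemma even_tail_path :
  path (route_edge m (t * m) t.+1) m.-1 (behead even_tail).
Proof.
rewrite -[m.-1]even_first; apply: path_descend => //.
  by move=> r i; apply: even_route_step.
by move=> r; apply: even_route_join.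
Qed.

Lemma even_tail_last : last m.-1 (behead even_tail) = t * m + (s == 0).
Proof.
have := @last_descend _ even_route even_size 0 m.-1.
rewrite (prednK m0) -/even_tail even_tail_cons /= => ->.
by rewrite even_last leqn0.
Qed.

Lemma even_tail_size : size even_tail = t.*2 * m + s.
Proof.
rewrite /even_tail size_descend sum_step (minn_idPr (ltnW lt_sm)).
by rewrite prednK ?double_gt0 // mulnC.
Qed.

Lemma mem_even_tail (v : nat) : v <= t.*2 * m + s ->
  v \in (t * m + s) :: even_tail.
Proof.
move=> le_v; rewrite inE.
have mem r i w : w = even_route r i -> r < m -> i <= even_size r ->
  (v == t * m + s) || (w \in even_tail).
  by move=> -> lt_r le_i; rewrite mem_descend ?orbT.
have [lt_v|le_tv] := ltnP v (t * m).
  have lt_j : v %/ m < t by rewrite ltn_divLR.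
  apply: (mem (v %% m) (v %/ m).*2); last 2 first.
  - exact: ltn_pmod.
  - by rewrite /even_size; lia.
  rewrite /even_route (_ : _ || _) ?zig_even; last by lia.
  by rewrite addnC -divn_eq.
have [le_vm|lt_mv] := leqP v (t * m + m).
  have [y Ey] : exists y, v = t * m + y by exists (v - t * m); lia.
  case: (ltngtP y s) => h; last by rewrite Ey h eqxx.
  - apply: (mem y (even_size y)) => //; last by lia.
    by rewrite even_last Ey; lia.
  - apply: (mem y.-1 (even_size y.-1)) => //; last by lia.
    by rewrite even_last Ey; lia.
pose w := v - (t * m + m.+1).
have Ew : v = t.+1 * m + w + 1 by rewrite /w; lia.
have Dw := divn_eq w m; have Rw := ltn_pmod w m0.
have lt_w : w < t.-1 * m + s by rewrite -(prednK t0) in le_v Ew *; lia.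
have lt_j : (w %/ m).+1 < t + (w %% m < s).
  rewrite ltnNge; apply/negP => le_t.
  have : (t.-1 + (w %% m < s)) * m <= w %/ m * m by rewrite leq_mul2r; lia.
  by case: (ltnP (w %% m) s); lia.
apply: (mem (w %% m) (w %/ m).*2.+1) => //; last by rewrite /even_size; lia.
rewrite /even_route (_ : _ || _) ?zig_odd; last by lia.
by lia.
Qed.

End EvenRoute.

(** * The listing for an odd quotient *)

Section OddRoute.

Variables (m p s : nat).
Hypotheses (m0 : 0 < m) (lt_sm : s < m).

(* For [n = (2 p + 1) m + s] and the clique [[p m, p m + m]]: a clique vertex,
   followed by the [r]-th zigzag.  The listing ends with [p m + s], whose edge
   has a defect unless [s = 0]. *)
Definition odd_route (r i : nat) : nat :=
  if i is i'.+1 then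
    if r < s then zig m (p.+1 * m + r).+1 r i'
    else zig m r (p.+1 * m + r).+1 i'
  else p * m + (r + (s <= r)).

(** For [r < s] the right class has [p + 1] vertices against [p] on the left, so the zigzag begins
    and ends on the right; otherwise both have [p]. *)
Definition odd_size (r : nat) : nat := p.*2 + (r < s).

Lemma odd_last_lt (r : nat) : r < s ->
  odd_route r (odd_size r) = (p.+1 * m + r).+1 + p * m.
Proof. by move=> lt_r; rewrite /odd_route /odd_size lt_r addn1 zig_even. Qed.

(** With [p = 0] the block consists of its clique vertex alone. *)
Lemma odd_last_ge (r : nat) : s <= r ->
  odd_route r (odd_size r) =
    if 0 < p then (p.+1 * m + r).+1 + p.-1 * m else p * m + r.+1.
Proof.
rewrite leqNgt /odd_route /odd_size => /negbTE ge_r; rewrite ge_r addn0.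
by case: (posnP p) => [->|p0]; [rewrite leqNgt ge_r addn1
  | rewrite -{1}(prednK p0) doubleS /= zig_odd].
Qed.

Lemma odd_route_step (r i : nat) : r < m -> i < odd_size r ->
  route_edge m (p * m) (p.+1 + (0 < s)) (odd_route r i) (odd_route r i.+1).
Proof.
move=> lt_r; rewrite /odd_size /odd_route; case: (ltnP r s) => h.
  have -> : 0 < s by lia.
  case: i => [_|i lt_i].
    rewrite /zig /= mul0n !addn0 -[X in route_edge _ _ _ _ X]addn0 -(mul0n m).
    by apply: edge_center_right => //; lia.
  apply: (@zig_edge _ _ _ _ p.*2) => // [j lt_j|j lt_j|]; last by lia.
    by apply: (@edge_right_left _ _ _ _ _ _ (p - j)) => //; lia.
  by apply: (@edge_left_right _ _ _ _ _ _ (p - j)) => //; lia.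
case: i => [lt_i|i lt_i].
  have := @edge_center_left m p (p.+1 + (0 < s)) r 0 p r.+1.
  by rewrite /zig /= addn1; apply => //; lia.
apply: (@zig_edge _ _ _ _ p.*2.-1) => // [j lt_j|j lt_j|]; last by lia.
  by apply: (@edge_left_right _ _ _ _ _ _ (p - j)) => //; lia.
by apply: (@edge_right_left _ _ _ _ _ _ (p - j.+1)) => //; lia.
Qed.

(** Every [y <= r] is covered, to serve both the joins between blocks and, when [s = 0], the edge to
    the closing vertex [p m]. *)
Lemma odd_route_center (r y : nat) : r < m -> y <= r ->
  route_edge m (p * m) (p.+1 + (0 < s))
    (odd_route r (odd_size r)) (p * m + y).
Proof.
move=> lt_r le_y; case: (ltnP r s) => h.
  by rewrite odd_last_lt //; apply: edge_right_center => //; lia.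
rewrite odd_last_ge //; case: (posnP p) => [->|p0].
  have := @edge_center_left m 0 (1 + (0 < s)) y 0 0 r.+1.
  by rewrite mul0n !addn0 !add0n; apply => //; lia.
by apply: edge_right_center => //; lia.
Qed.

Lemma odd_route_join (r : nat) : r.+1 < m ->
  route_edge m (p * m) (p.+1 + (0 < s))
    (odd_route r.+1 (odd_size r.+1)) (odd_route r 0).
Proof. by move=> lt_r; apply: odd_route_center; lia. Qed.

Definition odd_head : nat := odd_route m.-1 0.

Definition odd_tail : seq nat := behead (descend odd_route odd_size m).

Lemma odd_headE : odd_head = p * m + m.
Proof. by rewrite /odd_head /odd_route; lia. Qed.

Lemma odd_tail_path :
  path (route_edge m (p * m) (p.+1 + (0 < s))) odd_head odd_tail.
Proof.
apply: path_descend => //; first by move=> r i; apply: odd_route_step.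
by move=> r; apply: odd_route_join.
Qed.

Lemma odd_tail_last : last odd_head odd_tail = odd_route 0 (odd_size 0).
Proof.
have := @last_descend _ odd_route odd_size 0 m.-1.
by rewrite (prednK m0) descend_cons.
Qed.

Lemma odd_tail_size : size odd_tail = (p.*2.+1 * m + s).-1.
Proof.
rewrite size_behead size_descend sum_step (minn_idPr (ltnW lt_sm)).
by rewrite mulnC.
Qed.

Lemma mem_odd_tail (v : nat) : v <= p.*2.+1 * m + s ->
  v \in odd_head :: rcons odd_tail (p * m + s).
Proof.
move=> le_v; rewrite -rcons_cons mem_rcons inE.
rewrite /odd_head /odd_tail -descend_cons //.
have mem r i w : w = odd_route r i -> r < m -> i <= odd_size r ->
  (v == p * m + s) || (w \in descend odd_route odd_size m).
  by move=> -> lt_r le_i; rewrite mem_descend ?orbT.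
have [lt_v|le_tv] := ltnP v (p * m).
  have lt_j : v %/ m < p by rewrite ltn_divLR.
  have Ev : v = v %% m + v %/ m * m by rewrite addnC -divn_eq.
  have [h|h] := boolP (v %% m < s).
    apply: (mem (v %% m) (v %/ m).*2.+2); rewrite ?ltn_pmod // /odd_size ?h.
      by rewrite /= h zig_odd.
    by lia.
  apply: (mem (v %% m) (v %/ m).*2.+1); rewrite ?ltn_pmod // /odd_size.
    by rewrite /= (negbTE h) zig_even.
  by lia.
have [le_vm|lt_mv] := leqP v (p * m + m).
  have [y Ey] : exists y, v = p * m + y by exists (v - p * m); lia.
  case: (ltngtP y s) => h; last by rewrite Ey h eqxx.
  - by apply: (mem y 0) => //; rewrite /odd_route; lia.
  - by apply: (mem y.-1 0) => //; rewrite /odd_route; lia.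
pose w := v - (p * m + m.+1).
have Ew : v = p.+1 * m + w + 1 by rewrite /w; lia.
have Dw := divn_eq w m; have Rw := ltn_pmod w m0.
have lt_w : w < p * m + s by lia.
have lt_j : w %/ m < p + (w %% m < s).
  rewrite ltnNge; apply/negP => le_t.
  have : (p + (w %% m < s)) * m <= w %/ m * m by rewrite leq_mul2r le_t orbT.
  by case: (ltnP (w %% m) s); lia.
have [h|h] := boolP (w %% m < s).
  apply: (mem (w %% m) (w %/ m).*2.+1); rewrite // /odd_size ?h.
    by rewrite /= h zig_even; lia.
  by lia.
apply: (mem (w %% m) (w %/ m).*2.+2); rewrite // /odd_size.
  by rewrite /= (negbTE h) zig_odd; lia.
by lia.
Qed.

End OddRoute.

(** * The radio number by parity of the quotient *)

Lemma route_length_rcons (m x y : nat) (s : seq nat) :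
  route_length m x (rcons s y) = route_length m x s + pdist m (last x s) y.
Proof. by elim: s x => [|z s IHs] x /=; rewrite ?addn0 // IHs addnA. Qed.

(** A covering list of this length has no room for repetitions, so distinctness of the listed
    vertices is never checked directly. *)
Lemma perm_iota_cover (n : nat) (w : seq nat) : size w = n.+1 ->
  (forall v, v <= n -> v \in w) -> perm_eq w (iota 0 n.+1).
Proof.
move=> sz hw; have sub : {subset iota 0 n.+1 <= w}.
  by move=> v; rewrite mem_iota => /hw.
have le : size w <= size (iota 0 n.+1) by rewrite sz size_iota.
have [_ eqm] := uniq_min_size (iota_uniq 0 n.+1) sub le.
rewrite perm_sym; apply: uniq_perm => //; first exact: iota_uniq.
exact: leq_size_uniq (iota_uniq _ _) sub le.
Qed.

(* Only an edge entering the right half from the left one may have length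
   [b + 1], and two such edges are never consecutive. *)
Lemma radio_chromatic_route (m n k c b x : nat) (s : seq nat) : 0 < m ->
  perm_eq (x :: s) (iota 0 n.+1) -> cdiv m n <= k -> b.*2.+1 <= k.+2 ->
  path (fun u v => pdist m u v <= b + (u < c <= v)) x s ->
  radio_chromatic (path_power n m) k + route_length m x s <= n * k.+1.
Proof.
move=> m0 pw dk bk ps; apply: radio_chromatic_upper => //.
  by move=> u v le_u le_v; apply: leq_trans dk; apply: leq_cdiv => //; lia.
have szs : size s = n by have := perm_size pw; rewrite size_iota => -[].
move=> i lt_i; have /(pathP 0) h := ps.
have := h i; have := h i.+1; rewrite szs lt_i (ltnW lt_i) => /(_ isT) h1 /(_ isT) h2.
have arith u v w d1 d2 : d1 <= b + (v < c <= w) -> d2 <= b + (u < c <= v) ->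
  d2 + d1 <= k.+2 by lia.
exact: arith h1 h2.
Qed.

Lemma route_edge_level (m c b : nat) :
  subrel (route_edge m c b) (fun u v => level m c u + level m c v < pdist m u v).
Proof. by move=> u v /andP[]. Qed.

Lemma route_edge_le (m c b : nat) :
  subrel (route_edge m c b) (fun u v => pdist m u v <= b + (u < c <= v)).
Proof. by move=> u v /andP[]. Qed.

Lemma radio_chromatic_even (m t s k : nat) : 0 < m -> 0 < t -> s < m ->
  cdiv m (t.*2 * m + s) < k ->
  radio_chromatic (path_power (t.*2 * m + s) m) k + 2 * (t * (t * m + s))
    = (t.*2 * m + s) * k + 1.
Proof.
move=> m0 t0 lt_sm; rewrite cdivMD //; set n := t.*2 * m + s => hk.
have nE : n = t.*2 * m + s by [].
have leC : t * m + m <= n by nia.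
have n0 : 0 < n by lia.
have sumL : 2 * (\sum_(v <- iota 0 n.+1) level m (t * m) v) = 2 * (t * (t * m + s)).
  have E0 := cdiv_sumE m t 0 m0 (leq0n m); rewrite addn0 in E0.
  rewrite sum_level // mulnDr E0.
  have [d td] : exists d, t = d.+1 by exists t.-1; rewrite prednK.
  have -> : n - (t * m + m) = d * m + s by rewrite nE td; lia.
  by rewrite cdiv_sumE ?(ltnW lt_sm) // td; ring.
have pw : perm_eq (t * m + s :: even_tail m t s) (iota 0 n.+1).
  apply: perm_iota_cover; first by rewrite /= even_tail_size.
  by move=> v; apply: mem_even_tail.
have lv : level m (t * m) m.-1 = t.
  by have := @level_left m t 0 t m.-1; rewrite mul0n addn0; apply; lia.
(* The level bound for this edge is [t + 1], so the length [t] is the defect of one. *)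
have d1 : pdist m (t * m + s) m.-1 = t.
  by case: (t) t0 => // d _; apply: pdist_eq => //; lia.
have tE := @even_tail_cons m t s m0 t0 lt_sm.
have pT := @even_tail_path m t s m0 t0 lt_sm.
apply/eqP; rewrite eqn_leq; apply/andP; split.
- have := @radio_chromatic_route m n k (t * m) t.+1 _ _ m0 pw.
  have -> : path (fun u v => pdist m u v <= t.+1 + (u < t * m <= v))
    (t * m + s) (even_tail m t s).
    rewrite tE /= d1 (sub_path (@route_edge_le _ _ _) pT) andbT; lia.
  have := route_length_level_path _ _ _ _ (sub_path (@route_edge_level _ _ _) pT).
  rewrite -tE even_tail_last // lv level_center //; last by case: (s == 0).
  have : size (behead (even_tail m t s)) = n.-1.
    by rewrite size_behead even_tail_size.
  move=> ->; have := perm_big _ pw => /= H.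
  move: sumL; rewrite -H big_cons level_center ?(ltnW lt_sm) // => sumL.
  rewrite [in route_length _ (t * m + s) _]tE /= d1 sumL => h1 h2.
  have dk : cdiv m n <= k by rewrite nE cdivMD //; lia.
  have bk : t.+1.*2.+1 <= k.+2 by lia.
  by have := h2 dk bk isT; rewrite mulnS; lia.
(* The clique is off centre: [c = t m] exceeds [n - m - c = (t - 1) m + s]. *)
have H x s' : perm_eq (x :: s') (iota 0 n.+1) ->
  route_length m x s' <= 2 * (t * (t * m + s)) + n.-1.
  move=> pxs; have := @route_length_lt_level m n (t * m) x s' m0.
  rewrite (perm_big _ pxs) sumL => h.
  have : route_length m x s' < 2 * (t * (t * m + s)) + n.
    by apply: h; rewrite ?muln_gt0 ?t0 //; lia.
  by lia.
have := @radio_chromatic_lower m n k _ m0 H.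
by rewrite mulnS; lia.
Qed.

Lemma radio_chromatic_odd (m p s k : nat) : 0 < m -> s < m ->
  cdiv m (p.*2.+1 * m + s) < k ->
  radio_chromatic (path_power (p.*2.+1 * m + s) m) k + 2 * (p.+1 * (p * m + s))
    = (p.*2.+1 * m + s) * k + (0 < s).
Proof.
move=> m0 lt_sm; rewrite cdivMD //; set n := p.*2.+1 * m + s => hk.
have nE : n = p.*2.+1 * m + s by [].
have n0 : 0 < n by rewrite nE mulSn; lia.
have hs : (0 < s) <= cdiv m s.
  by case: posnP => // s0; rewrite ltnNge cdiv_leq //; lia.
(* The level sum is the same for all these cliques. The listing is measured at [a = 0], while
   strictness is obtained at [a = s], where the clique is off centre once [0 < s]. *)
have sumL a : a <= s ->
  2 * (\sum_(v <- iota 0 n.+1) level m (p * m + a) v) = 2 * (p.+1 * (p * m + s)).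
  move=> le_a; rewrite sum_level //; last by rewrite nE; lia.
  have -> : n - (p * m + a + m) = p * m + (s - a) by rewrite nE; lia.
  rewrite mulnDr !cdiv_sumE //; try lia.
  have [d ->] : exists d, s = a + d by exists (s - a); lia.
  by rewrite addKn; ring.
have sum0 := sumL 0 (leq0n s); rewrite addn0 in sum0.
pose x0 := odd_head m p s; pose w := odd_tail m p s.
have pw : perm_eq (x0 :: rcons w (p * m + s)) (iota 0 n.+1).
  apply: perm_iota_cover; last by move=> v; apply: mem_odd_tail.
  by rewrite /= size_rcons odd_tail_size // prednK.
have pT := @odd_tail_path m p s m0 lt_sm.
apply/eqP; rewrite eqn_leq; apply/andP; split.
- have H := perm_big _ pw; have {H}sum1 := H _ _ _ predT (level m (p * m)).
  have lx0 : level m (p * m) x0 = 0 by rewrite /x0 odd_headE // level_center.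
  have ls : level m (p * m) (p * m + s) = 0 by rewrite level_center // ltnW.
  have szw : size w = n.-1 by rewrite odd_tail_size.
  have [hp hd] : pdist m (last x0 w) (p * m + s)
        <= p.+1 + (0 < s) + (last x0 w < p * m <= p * m + s) /\
    2 * (p.+1 * (p * m + s)) + n <=
      route_length m x0 (rcons w (p * m + s)) + (0 < s).
    rewrite -sum0 -sum1 -rcons_cons -cats1 big_cat big_seq1 /= ls addn0.
    have := route_length_level_path _ _ _ _ (sub_path (@route_edge_level _ _ _) pT).
    rewrite -/x0 -/w lx0 szw addn0 route_length_rcons odd_tail_last //.
    case: (posnP s) => [s0|s0].
      have ed := @odd_route_center m p s m0 lt_sm 0 0 m0 (leqnn 0).
      rewrite s0 in ed *.
      have /andP[] := ed.
      by rewrite level_center // !addn0 => e1 e2 e3; split=> //; lia.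
    rewrite odd_last_lt // level_right //.
    (* The level bound here is [p + 2]: this edge carries the defect. *)
    have -> : pdist m ((p.+1 * m + 0).+1 + p * m) (p * m + s) = p.+1.
      by apply: pdist_eq => //; lia.
    by split; lia.
  have dk : cdiv m n <= k by rewrite nE cdivMD //; lia.
  (* For [0 < s] and the least admissible [k = 2 p + 3] this is an equality. *)
  have bk : (p.+1 + (0 < s)).*2.+1 <= k.+2 by lia.
  have := @radio_chromatic_route m n k (p * m) (p.+1 + (0 < s)) _ _ m0 pw dk bk.
  rewrite rcons_path (sub_path (@route_edge_le _ _ _) pT) /=.
  rewrite hp => /(_ isT).
  by rewrite mulnS; lia.
have H x s' : perm_eq (x :: s') (iota 0 n.+1) ->
  route_length m x s' <= 2 * (p.+1 * (p * m + s)) + n - (0 < s).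
  move=> pxs; case: (posnP s) => [s0|s0].
    have := route_length_le_level m (p * m) x s' m0.
    have -> : size s' = n by have := perm_size pxs; rewrite size_iota => -[].
    by rewrite (perm_big _ pxs) sum0; lia.
  have := @route_length_lt_level m n (p * m + s) x s' m0.
  rewrite (perm_big _ pxs) (sumL s (leqnn s)) => h.
  have : route_length m x s' < 2 * (p.+1 * (p * m + s)) + n.
    by apply: h => //; rewrite ?nE; lia.
  by lia.
have := @radio_chromatic_lower m n k _ m0 H.
by rewrite mulnS; lia.
Qed.

(** * The closed formula over the rationals *)

Local Open Scope ring_scope.

Lemma ceil_divn (m n : nat) : (0 < m)%N ->
  Num.ceil (n%:R / m%:R : rat) = cdiv m n.
Proof.
move=> m0; apply: ceil_def; have mpos : (0 : rat) < m%:R by rewrite ltr0n.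
have := cdivl m n m0; have : (cdiv m n * m < n + m)%N.
  by have := leq_divM (n + m.-1) m; rewrite /cdiv; lia.
rewrite ltr_pdivlMr // ler_pdivrMr // intrB -!pmulrn mulrBl mul1r ltrBlDr.
by rewrite -natrM -natrD ltr_nat ler_nat => -> ->.
Qed.

(** For [n < m] the graph is complete and the radio number is [n k], whereas the second case would
    give [n k + 1]; [hmn] excludes this. *)
Theorem theorem1p8 (m n k : nat) (hm : (0 < m)%N) (hn : (0 < n)%N)
    (hmn : (m <= n)%N) (hk : (diam (path_power n m) < k)%N) :
  let s := (n %% m)%N in
  (radio_chromatic (path_power n m) k)%:R =
    (if odd `|Num.ceil (n%:R / m%:R : rat)|%N then
       if (m %| n)%N then n%:R * k%:R - (n%:R ^+ 2 - m%:R ^+ 2) / (2 * m%:R)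
       else n%:R * k%:R - (n%:R ^+ 2 - s%:R ^+ 2) / (2 * m%:R) + 1
     else
       if (m %| n)%N then n%:R * k%:R - n%:R ^+ 2 / (2 * m%:R) + 1
       else n%:R * k%:R - (n%:R ^+ 2 - (m%:R - s%:R) ^+ 2) / (2 * m%:R) + 1)
    :> rat.
Proof.
move=> s; have lt_sm : (s < m)%N by exact: ltn_pmod.
have m_neq0 : m%:R != 0 :> rat by rewrite pnatr_eq0 -lt0n.
have {}hk : (cdiv m n < k)%N.
  apply: leq_ltn_trans hk; rewrite -[X in cdiv m X](subn0 n) -[X in cdiv m X]add0n.
  rewrite -[X in (X + _)%N](sub0n n).
  rewrite -[cdiv _ _]/(pdist m (ord0 : 'I_n.+1) (ord_max : 'I_n.+1)).
  rewrite -gdist_path_power //.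
  by apply: leq_trans (leq_bigmax ord0); apply: (leq_bigmax (F := gdist _ _)).
have cdiv_s : cdiv m s = (0 < s)%N.
  by apply: cdiv_eq => //; case: posnP => [->|]; lia.
rewrite ceil_divn // absz_nat.
have dvd_s : (m %| n)%N = (s == 0)%N by [].
have addn_eqR a b c : (a + b)%N = c -> a%:R = c%:R - b%:R :> rat.
  by move=> <-; rewrite natrD addrK.
have En : n = (n %/ m * m + s)%N by exact: divn_eq.
(* The four cases are regrouped by the parity of the quotient; the ceiling is the quotient plus one
   when [0 < s], which swaps the parities. *)
have [t [b Eq]] : exists t (b : bool), (n %/ m)%N = (t.*2 + b)%N.
  by exists (n %/ m)./2, (odd (n %/ m)); rewrite addnC odd_double_half.
clearbody s; rewrite dvd_s {dvd_s}; rewrite {}Eq in En.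
case: b En => En; rewrite ?addn1 ?addn0 in En; rewrite En cdivMD // cdiv_s in hk *.
- have H := radio_chromatic_odd m t s k hm lt_sm; rewrite cdivMD // cdiv_s in H.
  have {H hk}-> := addn_eqR _ _ _ (H hk).
  rewrite -muln2 oddD /= oddM andbF; case: (posnP s) => [->|s0] /=.
    by rewrite !addn0; field.
  by field.
have t0 : (0 < t)%N by rewrite lt0n; apply/eqP => t0; rewrite t0 in En; lia.
have H := radio_chromatic_even m t s k hm t0 lt_sm; rewrite cdivMD // cdiv_s in H.
have {H hk}-> := addn_eqR _ _ _ (H hk).
rewrite -muln2 oddD oddM andbF; case: (posnP s) => [->|s0] /=.
  by rewrite !addn0; field.
by field.
Qed.
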